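(* Let $n\ge 2$. The face poset of the coarse subdivision of $\mathcal{B}^+(K_n)$, with a $\widehat{1}$ attached, is dual to the face poset of the associahedron $A_{n-2}$; that is, the two posets are anti-isomorphic.
   Context: $K_n$ is the complete graph on vertices $1,\dots,n$ with edge set $E$, $|E|=\binom n2$, with edges oriented $i\to j$ for $i<j$. $M=M(K_n)$ is its graphical oriented matroid on $E$: signed circuits come from cycles of $K_n$ with a direction of traversal, $C^+$ being the edges crossed forward and $C^-$ those crossed backward. For $\omega\in\mathbb{R}^E$ and a signed circuit $C$ of $M$, $\operatorname{in}_\omega(C)$ denotes the signed set of elements of $C$ of largest $\omega$-weight among the elements of $C$, with the signs they have in $C$. $M_\omega$ is the oriented matroid on $E$ whose signed circuits are the inclusion-minimal members (with respect to supports) of $\{\operatorname{in}_\omega(C)\}$, $C$ ranging over the signed circuits of $M$. Let $S=\{\omega\in\mathbb{R}^E : \sum_e\omega_e=0,\ \sum_e\omega_e^2=1\}$. The positive Bergman complex is $\mathcal{B}^+(K_n)=\{\omega\in S : M_\omega\text{ is acyclic}\}$ (acyclic: no all-positive signed circuit). The coarse subdivision of $\mathcal{B}^+(K_n)$ is its subdivision into classes where $u,v$ lie in the same cell iff $M_u=M_v$. Its face poset consists of the cells ordered by inclusion of their closures, together with the empty cell as least element; $\widehat 1$ is an added greatest element. The associahedron $A_{n-2}$ is the $(n-2)$-dimensional polytope whose nonempty faces correspond bijectively to planar rooted trees with $n$ leaves in which every internal vertex has at least two children (vertices corresponding to binary trees), the face of $T$ being contained in the face of $T'$ iff $T'$ is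 obtained from $T$ by contracting internal edges. Its face poset includes the empty face and the whole polytope. *)

(* Defs.v *)
From mathcomp Require Import all_boot all_order all_algebra.
From mathcomp Require Import all_classical all_reals all_analysis.
From Stdlib Require Import Relation_Operators.

Set Implicit Arguments.
Unset Strict Implicit.
Unset Printing Implicit Defensive.

Import Order.TTheory GRing.Theory Num.Theory.
Import numFieldNormedType.Exports.
Local Open Scope classical_set_scope.
Local Open Scope ring_scope.

(** * Oriented matroids, given by their signed circuits *)

(* The pair (C^+, C^-).  Disjointness of the two parts is not imposed by the
   type: it holds for the circuits of [graphical_om] below (cycles have length
   at least 3) and is preserved by [initial]. *)
Definition signed_set (E : finType) := ({set E} * {set E})%type.

Definition supp (E : finType) (C : signed_set E) : {set E} := C.1 :|: C.2.

(* An oriented matroid on E is identified with its set of signed circuits. *)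
Definition signed_circuits (E : finType) := set (signed_set E).

Definition acyclic (E : finType) (M : signed_circuits E) : Prop :=
  ~ exists2 C, M C & C.2 = finset.set0.

Section Bergman.
Variables (R : realType) (E : finType).
Implicit Types (M : signed_circuits E) (w : {ptws E -> R}).

Definition max_weight w (A : {set E}) : {set E} :=
  [set e in A | [forall f in A, w f <= w e]]%SET.

Definition initial w (C : signed_set E) : signed_set E :=
  (C.1 :&: max_weight w (supp C), C.2 :&: max_weight w (supp C))%SET.

Definition initial_om M w : signed_circuits E :=
  [set D | (initial w @` M) D /\
           forall D', (initial w @` M) D' -> ~~ (supp D' \proper supp D)].

Definition weight_sphere : set {ptws E -> R} :=
  [set w | \sum_e w e = 0 /\ \sum_e w e ^+ 2 = 1].

Definition positive_bergman M : set {ptws E -> R} :=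
  [set w | weight_sphere w /\ acyclic (initial_om M w)].

Definition coarse_class M w : set {ptws E -> R} :=
  [set v | positive_bergman M v /\ initial_om M v = initial_om M w].

Definition coarse_cells M : set (set {ptws E -> R}) :=
  [set set0] `|` coarse_class M @` positive_bergman M.

(* Closures are taken in R^E; as the sphere is closed there, these are also the
   closures in the sphere. *)
Definition cell_le M (c d : coarse_cells M) : Prop :=
  closure (\val c) `<=` closure (\val d).

End Bergman.

(** * The oriented matroid of the complete graph *)

(* The vertices 1, ..., n are represented by 0, ..., n-1. *)
Definition edge (n : nat) := {e : 'I_n * 'I_n | (e.1 < e.2)%N}.

Definition forward_edges n (s : seq 'I_n) : {set edge n} :=
  [set e : edge n | ((\val e).1 \in s) && (next s (\val e).1 == (\val e).2)]%SET.

Definition backward_edges n (s : seq 'I_n) : {set edge n} :=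
  [set e : edge n | ((\val e).2 \in s) && (next s (\val e).2 == (\val e).1)]%SET.

Definition graphical_om (n : nat) : signed_circuits (edge n) :=
  [set C | exists s : seq 'I_n,
    [/\ uniq s, (2 < size s)%N & C = (forward_edges s, backward_edges s)]].

(** * The face poset of the associahedron *)

Inductive ptree : Type := Leaf | Node of seq ptree.

Fixpoint nleaves (t : ptree) : nat :=
  if t is Node s then sumn (map nleaves s) else 1%N.

Fixpoint reduced (t : ptree) : bool :=
  if t is Node s then (1 < size s)%N && all reduced s else true.

(* Contraction of one internal edge: the children of a non-root internal vertex
   take its place, in order, among the children of its parent. *)
Inductive contract1 : ptree -> ptree -> Prop :=
| Contract_root (l m r : seq ptree) :
    contract1 (Node (l ++ Node m :: r)) (Node (l ++ m ++ r))
| Contract_sub (l r : seq ptree) (t t' : ptree) :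
    contract1 t t' -> contract1 (Node (l ++ t :: r)) (Node (l ++ t' :: r)).

Definition contracts : ptree -> ptree -> Prop := clos_refl_trans ptree contract1.

Definition reduced_tree (n : nat) := {t : ptree | reduced t && (nleaves t == n)}.

Definition tree_le n (T T' : reduced_tree n) : Prop :=
  contracts (\val T) (\val T').

(** * Posets *)

Definition top_le (T : Type) (le : T -> T -> Prop) (x y : option T) : Prop :=
  match x, y with
  | _, None => True
  | Some a, Some b => le a b
  | None, Some _ => False
  end.

Definition bot_le (T : Type) (le : T -> T -> Prop) (x y : option T) : Prop :=
  match x, y with
  | None, _ => True
  | Some a, Some b => le a b
  | Some _, None => False
  end.

Definition anti_isomorphic (X Y : Type) (leX : X -> X -> Prop)
    (leY : Y -> Y -> Prop) : Prop :=
  exists f : X -> Y, bijective f /\ forall x y, leX x y <-> leY (f y) (f x).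

Definition bergman_face_le (R : realType) (n : nat) :
    option (coarse_cells (R := R) (@graphical_om n)) ->
    option (coarse_cells (R := R) (@graphical_om n)) -> Prop :=
  top_le (@cell_le R (edge n) (@graphical_om n)).

(* The faces of the associahedron A_(n-2): [None] is the empty face and [Some T]
   the face of the tree T, the whole polytope being that of the tree with one
   internal vertex. *)
Definition assoc_face_le (n : nat) :
    option (reduced_tree n) -> option (reduced_tree n) -> Prop :=
  bot_le (@tree_le n).

(* Main.v *)
Require Import Defs.
From mathcomp Require Import all_boot all_order all_algebra.
From mathcomp Require Import all_classical all_reals all_analysis.
From mathcomp Require Import zify ring.
From Stdlib Require Import Relation_Operators.

(** Everything is read off the gaps 0, ..., n-2, gap p lying between the vertices
    (or leaves) p and p+1, through one preorder on gaps.

    On the Bergman side, a triangle i < j < k has the signed circuit with ij, jk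
    positive and ik negative, so acyclicity of M_w forces w_ik = max(w_ij, w_jk).
    Hence w is determined by the weights h_p of the edges {p, p+1}, each w_ij
    being the maximum of h over the gaps between i and j ([acyclic_ultra]).
    Conversely such a w gives an acyclic M_w ([ultra_acyclic]): a cycle that has
    vertices on both sides of a gap crosses it both upwards and downwards, and
    for a gap of largest h both crossings have maximal weight.  Say that p
    dominates q when h_p is the maximum of h between p and q.  The initial form
    of a cycle depends only on this relation ([dominates_initial_om]), and the
    relation can be read off the two-element circuits that M_w inherits from
    triangles ([initial_om_dominates]).  So the nonempty cells are the
    domination preorders of non-constant h; the empty cell gets the full relation,
    that of a constant h, which no point of the sphere has.

    Inclusion of cell closures is reverse inclusion of these preorders
    ([cell_leP]).  A failure of domination is a strict inequality, hence an open
    condition, which gives one direction.  For the other, if the preorder of v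
    is contained in that of u, then u + eps v has the preorder of v for every
    eps > 0, and it tends to u after normalisation ([comonotone_closure]).

    On the tree side, every node of a planar tree is an interval of leaves, and
    p is related to q when each such interval around the gap p also contains the
    gap q.  Contracting an edge deletes an interval and so enlarges the relation;
    conversely an inclusion of relations lets one rebuild the smaller tree by
    contractions, since a gap that separates children of the root of the first
    tree must do so in the second ([below_contracts]).  As contraction is
    antisymmetric, trees embed in preorders as well.

    Finally both sides yield the same preorders: minus the number of intervals
    around a gap is a function h whose domination is the relation of the tree
    ([dominates_cluster_depth]), and splitting an arbitrary h at its leftmost
    maximum builds a tree for it ([exists_tree]).  So cells and trees are
    identified, contraction being reverse closure inclusion, and the added top
    element corresponds to the empty face. *)

Set Implicit Arguments.
Unset Strict Implicit.
Unset Printing Implicit Defensive.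
Import Order.TTheory GRing.Theory Num.Theory.
Import numFieldNormedType.Exports.

(** * Planar trees as families of leaf intervals *)

(** Nested recursion through [seq]: a statement on trees is proved together with
    a companion [Q] on forests. *)
Lemma ptree_forest_ind (Q : seq ptree -> Prop) (P : ptree -> Prop) :
  P Leaf -> (forall s, Q s -> P (Node s)) ->
  Q [::] -> (forall t s, P t -> Q s -> Q (t :: s)) ->
  forall t, P t.
Proof.
move=> PL PN Q0 QS; fix IH 1 => -[|s]; first exact: PL.
by apply: PN; elim: s => [|t s IHs]; [exact: Q0 | apply: QS; [exact: IH|]].
Qed.

Local Notation leaves s := (sumn (map nleaves s)).

(** The nodes of a tree whose first leaf is numbered [a], each as the half-open
    interval of its leaves. *)
Fixpoint clusters (a : nat) (t : ptree) : seq (nat * nat) :=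
  (a, a + nleaves t)%N ::
  if t is Node s then
    (fix forest a s := if s is t :: s' then
       clusters a t ++ forest (a + nleaves t)%N s' else [::]) a s
  else [::].

Fixpoint forest_clusters (a : nat) (s : seq ptree) : seq (nat * nat) :=
  if s is t :: s' then clusters a t ++ forest_clusters (a + nleaves t)%N s'
  else [::].

(** The gap [p] lies between the leaves [p] and [p.+1]; both must be in [I]. *)
Definition covers (I : nat * nat) (p : nat) : bool :=
  (I.1 <= p)%N && (p.+1 < I.2)%N.

(** For the nodes of a tree: the node at which the leaves around the gap [p] part
    is an ancestor of, or equal to, the one at which those around [q] part. *)
Definition below (Is : seq (nat * nat)) (p q : nat) : Prop :=
  forall I : nat * nat, I \in Is -> covers I p -> covers I q.

Lemma clusters_node a s :
  clusters a (Node s) = (a, a + leaves s)%N :: forest_clusters a s.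
Proof. by []. Qed.

Lemma forest_clusters_cons a t s : forest_clusters a (t :: s) =
  clusters a t ++ forest_clusters (a + nleaves t)%N s.
Proof. by []. Qed.

Lemma root_cluster a t : (a, a + nleaves t)%N \in clusters a t.
Proof. by case: t => [|s]; rewrite /= mem_head. Qed.

Lemma forest_clusters_cat a s1 s2 :
  forest_clusters a (s1 ++ s2) =
  forest_clusters a s1 ++ forest_clusters (a + leaves s1)%N s2.
Proof.
elim: s1 a => [|t s1 IH] a /=; first by rewrite addn0.
by rewrite IH catA addnA.
Qed.

Lemma leaves_cat s1 s2 : leaves (s1 ++ s2) = (leaves s1 + leaves s2)%N.
Proof. by rewrite map_cat sumn_cat. Qed.

Lemma nleaves_gt0 t : reduced t -> (0 < nleaves t)%N.
Proof.
elim/(@ptree_forest_ind (fun s => all reduced s -> (0 < size s -> 0 < leaves s)%N)) : t => //=.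
- by move=> s IH /andP[s1 rs]; apply: IH => //; lia.
- by move=> t s IHt _ /andP[rt _] _; have := IHt rt; lia.
Qed.

Lemma leaves_gt0 s : all reduced s -> (0 < size s)%N -> (0 < leaves s)%N.
Proof. by case: s => //= t s /andP[/nleaves_gt0]; lia. Qed.

Lemma clusters_range a t (I : nat * nat) : I \in clusters a t ->
  (a <= I.1)%N && (I.2 <= a + nleaves t)%N.
Proof.
elim/(@ptree_forest_ind (fun s => forall a, I \in forest_clusters a s ->
  (a <= I.1)%N && (I.2 <= a + leaves s)%N)) : t a => //.
- by move=> a; rewrite inE => /eqP -> /=; lia.
- move=> s IH a; rewrite clusters_node inE => /orP[/eqP->/=|/IH //]; lia.
- move=> t s IHt IHs a /=; rewrite mem_cat => /orP[/IHt|/IHs] /=; lia.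
Qed.

Lemma forest_clusters_range a s (I : nat * nat) : I \in forest_clusters a s ->
  (a <= I.1)%N && (I.2 <= a + leaves s)%N.
Proof.
elim: s a => //= t s IHs a.
by rewrite mem_cat => /orP[/clusters_range|/IHs] /=; lia.
Qed.

Lemma clusters_laminar a t (I J : nat * nat) : I \in clusters a t -> J \in clusters a t ->
  [|| I.2 <= J.1, J.2 <= I.1, (J.1 <= I.1) && (I.2 <= J.2)
    | (I.1 <= J.1) && (J.2 <= I.2)]%N.
Proof.
elim/(@ptree_forest_ind (fun s => forall a, I \in forest_clusters a s ->
   J \in forest_clusters a s ->
  [|| I.2 <= J.1, J.2 <= I.1, (J.1 <= I.1) && (I.2 <= J.2)
    | (I.1 <= J.1) && (J.2 <= I.2)]%N)) : t a => //.
- by move=> a; rewrite !inE => /eqP -> /eqP -> /=; lia.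
- move=> s IH a; rewrite clusters_node !inE.
  move=> /orP[/eqP->|HI] /orP[/eqP->|HJ]; last exact: IH HI HJ.
  + by lia.
  + by have /= := forest_clusters_range HJ; lia.
  + by have /= := forest_clusters_range HI; lia.
- move=> t s IHt IHs a /=; rewrite !mem_cat.
  move=> /orP[HI|HI] /orP[HJ|HJ]; [exact: IHt HI HJ| | |exact: IHs HI HJ].
  + by have := clusters_range HI; have := forest_clusters_range HJ => /=; lia.
  + by have := clusters_range HJ; have := forest_clusters_range HI => /=; lia.
Qed.

Lemma contract1_clusters t t' : contract1 t t' -> nleaves t = nleaves t' /\
  forall a, {subset clusters a t' <= clusters a t}.
Proof.
elim=> {t t'} [l m r|l r t t' _ [nl sub]].
- have nl : leaves (l ++ Node m :: r) = leaves (l ++ m ++ r).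
    by rewrite !leaves_cat /=.
  split=> // a I; rewrite !clusters_node nl !inE => /orP[->//|HI].
  apply/orP; right; move: HI.
  rewrite !forest_clusters_cat forest_clusters_cons clusters_node !mem_cat in_cons.
  by case/or3P=> ->; rewrite ?orbT.
- have nl' : leaves (l ++ t :: r) = leaves (l ++ t' :: r).
    by rewrite !leaves_cat /= nl.
  split=> // a I; rewrite !clusters_node nl' !inE => /orP[->//|HI].
  apply/orP; right; move: HI; rewrite !forest_clusters_cat /= !mem_cat nl.
  by case/or3P=> [->//|/sub->|->]; rewrite ?orbT.
Qed.

Lemma contracts_below t t' : contracts t t' ->
  forall a p q, below (clusters a t) p q -> below (clusters a t') p q.
Proof.
elim=> {t t'} [t t' /contract1_clusters[_ sub] a p q H I /sub|//|].
  exact: H.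
by move=> x y z _ IH1 _ IH2 a p q /IH1/IH2.
Qed.

Fixpoint internal (t : ptree) : nat :=
  if t is Node s then (sumn (map internal s)).+1 else 0.

(** Contraction removes an internal vertex, whence its antisymmetry. *)
Lemma contracts_internal t t' : contracts t t' ->
  t = t' \/ (internal t' < internal t)%N.
Proof.
elim=> {t t'} [t t' H|t|x y z _ [->|IH1] _ [<-|IH2]]; [right| | | | |]; auto.
  elim: H => {t t'} [l m r|l r t t' _ IH] /=.
    by rewrite !map_cat !sumn_cat /= ; lia.
  by rewrite !map_cat !sumn_cat /=; lia.
by right; apply: ltn_trans IH1.
Qed.

Lemma contracts_antisym t t' : contracts t t' -> contracts t' t -> t = t'.
Proof.
by move=> /contracts_internal[//|H1] /contracts_internal[//|H2]; lia.
Qed.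

Lemma contracts_sub l r t t' : contracts t t' ->
  contracts (Node (l ++ t :: r)) (Node (l ++ t' :: r)).
Proof.
elim=> {t t'} [t t' H|t|x y z _ H1 _ H2].
- by apply: rt_step; apply: Contract_sub.
- exact: rt_refl.
- exact: rt_trans H1 H2.
Qed.

(** A gap inside no tree of a forest separates two consecutive trees of it. *)
Lemma forest_cut a b s : (a < b < a + leaves s)%N ->
  (forall I : nat * nat, I \in forest_clusters a s -> ~~ covers I b.-1) ->
  exists s1 s2, s = s1 ++ s2 /\ (a + leaves s1 = b)%N.
Proof.
elim: s a => [|t s IH] a /=; first by lia.
move=> ab unc.
have [bt|bt|bt] := ltngtP b (a + nleaves t).
- have := unc (a, a + nleaves t)%N; rewrite mem_cat root_cluster => /(_ isT).
  by rewrite /covers /=; lia.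
- have [|I HI|s1 [s2 [-> e]]] := IH (a + nleaves t)%N; first by lia.
    by apply: unc; rewrite mem_cat HI orbT.
  by exists (t :: s1), s2; split=> //=; lia.
- by exists [:: t], s; split=> //=; lia.
Qed.

(** What makes reducedness matter: among two or more siblings, none has all the
    leaves, so the root is recognisable from the intervals. *)
Lemma forest_cluster_proper a s (I : nat * nat) : (1 < size s)%N -> all reduced s ->
  I \in forest_clusters a s -> (I.1 <= a)%N -> (a + leaves s <= I.2)%N -> False.
Proof.
case: s => [|t [|t' s]] //= _ /and3P[/nleaves_gt0 t0 /nleaves_gt0 t'0 rs].
rewrite mem_cat => /orP[/clusters_range|]; first by lia.
by move=> HI; have /= := @forest_clusters_range _ (t' :: s) I HI; lia.
Qed.

(** The forest companion says that the children [s] of a node, whatever siblings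
    [l] stand on their left, contract to [s'] if every gap between consecutive
    trees of [s] is one in [s'] too.  It is proved one tree of [s] at a time: the
    gap after the first tree [t] cuts [s'] into [s1 ++ s2], [t] contracts to the
    tree with children [s1] by the induction hypothesis on trees, and contracting
    its edge to the parent releases [s1]. *)
Lemma below_contracts t a t' : reduced t -> reduced t' ->
  nleaves t = nleaves t' ->
  (forall p q, (a <= p)%N -> (p.+1 < a + nleaves t)%N ->
     (a <= q)%N -> (q.+1 < a + nleaves t)%N ->
     below (clusters a t) p q -> below (clusters a t') p q) ->
  contracts t t'.
Proof.
elim/(@ptree_forest_ind (fun s => forall a l s',
  (0 < size s)%N -> (0 < size s')%N -> all reduced s -> all reduced s' ->
  leaves s = leaves s' ->
  (forall p, (a <= p)%N -> (p.+1 < a + leaves s)%N ->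
     (forall I : nat * nat, I \in forest_clusters a s -> ~~ covers I p) ->
     (forall I : nat * nat, I \in forest_clusters a s' -> ~~ covers I p)) ->
  (forall p q, (a <= p)%N -> (p.+1 < a + leaves s)%N ->
     (a <= q)%N -> (q.+1 < a + leaves s)%N ->
     below (forest_clusters a s) p q -> below (forest_clusters a s') p q) ->
  contracts (Node (l ++ s)) (Node (l ++ s')))) : t a t'.
- move=> a [|s] _ rt' nl _; first exact: rt_refl.
  case: s rt' nl => [|t [|t' s]] //= /and3P[].
  by move=> /nleaves_gt0 ? /nleaves_gt0 ?; lia.
- move=> s IH a [|s'] /andP[s1 rs].
    by move=> _ /=; case: s s1 rs {IH} => [|t [|t' s]] //= _ /and3P[]
      /nleaves_gt0 ? /nleaves_gt0 ?; lia.
  move=> /= /andP[s1' rs'] nl H.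
  apply: (IH a [::]) => //; [by lia|by lia| |].
  (* A gap separating children of the root dominates every gap, so an interval
     around it in the second tree would contain all leaves. *)
  + move=> p ap pb unc I HI; apply/negP => Ip.
    have full q : (a <= q)%N -> (q.+1 < a + leaves s)%N -> covers I q.
      move=> aq qb; apply: (H p q ap pb aq qb _ I _ Ip); last first.
        by rewrite -/(clusters a (Node s')) clusters_node inE HI orbT.
      move=> J; rewrite -/(clusters a (Node s)) clusters_node inE.
      by case/orP=> [/eqP -> _|/unc/negP//]; rewrite /covers /=; lia.
    apply: (forest_cluster_proper s1' rs' HI).
      by have := full a (leqnn a); rewrite /covers; lia.
    have := full (a + leaves s).-2; rewrite /covers -nl; lia.
  + move=> p q ap pb aq qb Hpq I HI.
    apply: (H p q ap pb aq qb); last by rewrite -/(clusters a (Node s')) clusters_node inE HI orbT.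
    move=> J; rewrite -/(clusters a (Node s)) clusters_node inE.
    by case/orP=> [/eqP -> _|/Hpq//]; rewrite /covers /=; lia.
- by [].
- move=> t s IHt IHs a l s' _ s'0 /= /andP[rt rs] rs' nl unc H.
  have t0 := nleaves_gt0 rt.
  have [s1 [s2 [es' nl1 s20]]] : exists s1 s2, [/\ s' = s1 ++ s2,
      leaves s1 = nleaves t & (0 < size s2) = (0 < size s)]%N.
    case: (posnP (size s)) => [/size0nil s0|s_gt0].
      by exists s', [::]; rewrite cats0 -nl s0 /= addn0.
    have sl := leaves_gt0 rs s_gt0.
    have [||s1 [s2 [es' e]]] := @forest_cut a (a + nleaves t)%N s'.
    + by rewrite -nl; lia.
    + apply: unc; [lia|lia|] => I; rewrite mem_cat.
      case/orP => [/clusters_range|/forest_clusters_range]; rewrite /covers; lia.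
    exists s1, s2; split=> //; first by lia.
    case: s2 es' => [|//] es'.
    by move: nl; rewrite es' leaves_cat /=; lia.
  have {rs'}[rs1 rs2] : all reduced s1 /\ all reduced s2.
    by apply/andP; rewrite -all_cat -es'.
  have nl2 : leaves s = leaves s2.
    by move: nl; rewrite es' leaves_cat; lia.
  have fcl I : (I \in forest_clusters a s') = (I \in forest_clusters a s1)
      || (I \in forest_clusters (a + nleaves t)%N s2).
    by rewrite es' forest_clusters_cat nl1 mem_cat.
  have s10 : (0 < size s1)%N by case: (s1) nl1 => //=; lia.
  have block p q : (a <= p)%N -> (p.+1 < a + nleaves t)%N ->
     (a <= q)%N -> (q.+1 < a + nleaves t)%N ->
     below (clusters a t) p q -> below (forest_clusters a s1) p q.
    move=> ap pb aq qb Hpq I HI; apply: (H p q); try lia; last by rewrite fcl HI.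
    move=> J; rewrite mem_cat => /orP[/Hpq//|/forest_clusters_range].
    by rewrite /covers; lia.
  have step1 : contracts (Node (l ++ t :: s)) (Node (l ++ s1 ++ s)).
    case: s1 s10 nl1 rs1 block {es' fcl} => [//|u [|u' s1]] _ nl1 rs1 block.
      apply: contracts_sub; apply: (IHt a) => //.
      + by move: rs1 => /= /andP[].
      + by move: nl1 => /=; lia.
      + by move=> p q ap pb aq qb /(block p q ap pb aq qb); rewrite /= cats0.
    apply: (rt_trans _ _ _ (Node (l ++ Node (u :: u' :: s1) :: s))); last first.
      by apply: rt_step; apply: Contract_root.
    apply: contracts_sub; apply: (IHt a) => //.
    move=> p q ap pb aq qb Hpq I; rewrite clusters_node inE.
    case/orP=> [/eqP -> _|HI]; last exact: (block p q ap pb aq qb Hpq I HI).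
    by rewrite nl1 /covers /=; lia.
  (* The released trees [s1] join [l] as left siblings of the rest. *)
  apply: (rt_trans _ _ _ _ _ step1); rewrite es' !catA.
  case: (posnP (size s)) => [s0|s_gt0].
    have := s20; rewrite s0; case: (s2) => // _.
    by rewrite (size0nil s0) !cats0; exact: rt_refl.
  apply: (IHs (a + nleaves t)%N) => //; first by rewrite s20.
  + move=> p ap pb uncp I HI; apply: unc; [lia|lia| |by rewrite fcl HI orbT].
    move=> J; rewrite mem_cat => /orP[/clusters_range|/uncp//].
    by rewrite /covers; lia.
  + move=> p q ap pb aq qb Hpq I HI; apply: (H p q); [lia|lia|lia|lia| |by rewrite fcl HI orbT].
    move=> J; rewrite mem_cat => /orP[/clusters_range|/Hpq//].
    by rewrite /covers; lia.
Qed.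

Local Open Scope ring_scope.

(** * Domination for functions on gaps, and trees *)

Definition dominates (R : realType) (h : nat -> R) (p q : nat) : Prop :=
  forall l, (minn p q <= l <= maxn p q)%N -> h l <= h p.

Lemma count_le_in (T : eqType) (a1 a2 : pred T) (s : seq T) :
  (forall y, y \in s -> a1 y -> a2 y) -> (count a1 s <= count a2 s)%N.
Proof.
move=> sub; rewrite -[leqRHS](@eq_in_count _ (predU a1 a2)); last first.
  by move=> y /sub; rewrite /=; case: (a1 y) => // ->.
by apply: sub_count => y /= ->.
Qed.

Lemma count_lt (T : eqType) (a1 a2 : pred T) (s : seq T) x :
  (forall y, y \in s -> a1 y -> a2 y) -> x \in s -> a2 x -> ~~ a1 x ->
  (count a1 s < count a2 s)%N.
Proof.
move=> sub xs a2x /negbTE a1x.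
rewrite [ltnRHS](permP (perm_to_rem xs)) [ltnLHS](permP (perm_to_rem xs)) /=.
rewrite a1x a2x add0n add1n ltnS; apply: count_le_in => y /mem_rem.
exact: sub.
Qed.

Lemma exists_leftmost_max (R : realType) (h : nat -> R) a b : (a < b)%N ->
  exists c, [/\ (a <= c < b)%N, forall p, (a <= p < b)%N -> h p <= h c
    & forall p, (a <= p < c)%N -> h p < h c].
Proof.
elim: b => // b IH; rewrite ltnS leq_eqVlt => /predU1P[<-|/IH[c [cab cmax cl]]].
  exists a; split=> [|p|p]; [lia| |lia].
  by move=> H; have -> : p = a by lia.
have [le|lt] := leP (h b) (h c).
  exists c; split=> [|p H|//]; first by lia.
  by have [->//|?] := eqVneq p b; apply: cmax; lia.
exists b; split=> [|p H|p H]; first by lia.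
  by have [->//|?] := eqVneq p b; apply/ltW/(le_lt_trans _ lt)/cmax; lia.
by apply: (le_lt_trans _ lt); apply: cmax; lia.
Qed.

(** Depth realises the tree.  If the interval [I] contains the gap [p] but not
    [q], take the gap [l] just outside [I] on the side of [q]: by laminarity each
    interval around [l] contains [I], so [l] is strictly less deep than [p]. *)
Lemma dominates_cluster_depth (R : realType) a t p q :
  dominates (fun p => - (count (covers^~ p) (clusters a t))%:R : R) p q <->
  below (clusters a t) p q.
Proof.
split=> [dom I It Ip|H l pql]; last first.
  rewrite lerN2 ler_nat; apply: count_le_in => I It /= Ip.
  by have := H I It Ip; move: Ip; rewrite /covers; lia.
apply: contraT => Iq.
(* Outside [I], towards [q]. *)
pose l := if (q < I.1)%N then I.1.-1 else I.2.-1.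
have : (minn p q <= l <= maxn p q)%N.
  by move: Ip Iq; rewrite /covers /l; case: ifP; lia.
move/dom; rewrite lerN2 ler_nat leqNgt; apply: contraNT => _; apply: (@count_lt _ _ _ _ I) => //.
  move=> J Jt; have := clusters_laminar It Jt; move: Ip Iq.
  by rewrite /covers /l; case: ifP; lia.
by move: Ip Iq; rewrite /covers /l; case: ifP; lia.
Qed.

(** The tree of [h] splits at the leftmost maximum [c] into trees [t1] and [t2].
    When the maximum is attained again to the right of [c], the root of [t2] is at
    the same height as the new root and its children [s] are attached directly. *)
Lemma exists_tree (R : realType) (h : nat -> R) a k :
  exists t, [/\ reduced t, nleaves t = k.+1 & forall p q,
    (a <= p < a + k)%N -> (a <= q < a + k)%N ->
    dominates h p q <-> below (clusters a t) p q].
Proof.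
have [j] := ubnP k; elim: j a k => // j IH a k kj.
case: (posnP k) => [->|k0]; first by exists Leaf; split=> // p q; lia.
have [c [cab cmax cl]] := @exists_leftmost_max R h a (a + k)%N ltac:(lia).
have [t1 [r1 n1 d1]] := IH a (c - a)%N ltac:(lia).
have [t2 [r2 n2 d2]] := IH c.+1 (k - (c - a).+1)%N ltac:(lia).
have e1 : (a + nleaves t1 = c.+1)%N by lia.
have cdom q : (a <= q < a + k)%N -> dominates h c q.
  by move=> qb l H; apply: cmax; lia.
have ndom_l p q : (a <= p < c)%N -> (c <= q)%N -> ~ dominates h p q.
  by move=> pb cq /(_ c ltac:(lia)); rewrite leNgt cl.
pose maxr p := (c < p < a + k)%N && (h p == h c).
have [/existsP[m0]|/existsPn nomax] :=
  boolP [exists m : 'I_(a + k), maxr m]; last first.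
  exists (Node [:: t1; t2]); split=> /=; [by rewrite r1 r2|lia|].
  move=> p q pb qb.
  rewrite -/(clusters a (Node [:: t1; t2])).
  have cl2 I : (I \in clusters a (Node [:: t1; t2])) =
      [|| I == (a, a + k.+1)%N, I \in clusters a t1 | I \in clusters c.+1 t2].
    rewrite clusters_node inE /= cats0 mem_cat e1.
    by have -> : (nleaves t1 + (nleaves t2 + 0) = k.+1)%N by lia.
  have [pc|pc|pc] := ltngtP p c.
  + have [qc|qc] := ltnP q c.
      rewrite (d1 p q) //; [|lia|lia]; split=> H I HI.
        move: HI; rewrite cl2 => /or3P[/eqP->|/H//|/clusters_range].
          by rewrite /covers /=; lia.
        by rewrite /covers; lia.
      by apply: H; rewrite cl2 HI orbT.
    split=> [/ndom_l []//|H]; first by lia.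
    have := H (a, a + nleaves t1)%N; rewrite cl2 root_cluster orbT.
    by rewrite /covers /= => /(_ isT); lia.
  + have [qc|qc] := ltnP c q.
      rewrite (d2 p q) //; [|lia|lia]; split=> H I HI.
        move: HI; rewrite cl2 => /or3P[/eqP->|/clusters_range|/H//].
          by rewrite /covers /=; lia.
        by rewrite /covers; lia.
      by apply: H; rewrite cl2 HI !orbT.
    split=> [/(_ c) H|H].
      have := nomax (Ordinal (ltac:(lia) : (p < a + k)%N)).
      rewrite /maxr /= eq_le cmax ?H; lia.
    have := H (c.+1, c.+1 + nleaves t2)%N; rewrite cl2 root_cluster !orbT.
    by rewrite /covers /= => /(_ isT); lia.
  + rewrite pc; split=> [_|_]; last exact: cdom.
    move=> I; rewrite cl2 => /or3P[/eqP->|/clusters_range|/clusters_range].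
    * by rewrite /covers /=; lia.
    * by rewrite /covers; lia.
    * by rewrite /covers; lia.
set m := (m0 : nat) => /andP[mb /eqP hm].
case: t2 r2 n2 d2 => [|s] r2 n2 d2; first by move: n2 => /=; lia.
have /andP[s1 rs] : (1 < size s)%N && all reduced s by [].
exists (Node (t1 :: s)); split.
- by rewrite /= r1 rs; lia.
- by move: n2 => /=; lia.
move=> p q pb qb.
have els : leaves s = (k - (c - a)) %N by move: n2 => /=; lia.
have cl2 I : (I \in clusters a (Node (t1 :: s))) =
    [|| I == (a, a + k.+1)%N, I \in clusters a t1 | I \in forest_clusters c.+1 s].
  rewrite clusters_node inE forest_clusters_cons mem_cat e1 /=.
  by have -> : (nleaves t1 + leaves s = k.+1)%N by lia.
have below_s p' q' : (c < p' < a + k)%N -> (c < q' < a + k)%N ->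
    dominates h p' q' <-> below (forest_clusters c.+1 s) p' q'.
  move=> pb' qb'; rewrite (d2 p' q'); [|lia|lia]; split=> H I HI.
    by apply: H; rewrite clusters_node inE HI orbT.
  move: HI; rewrite clusters_node inE => /orP[/eqP->|/H//].
  by rewrite /covers /=; lia.
have [pc|pc|pc] := ltngtP p c.
- have [qc|qc] := ltnP q c.
    rewrite (d1 p q) //; [|lia|lia]; split=> H I HI.
      move: HI; rewrite cl2 => /or3P[/eqP->|/H//|/forest_clusters_range].
        by rewrite /covers /=; lia.
      by rewrite /covers; lia.
    by apply: H; rewrite cl2 HI orbT.
  split=> [/ndom_l []//|H]; first by lia.
  have := H (a, a + nleaves t1)%N; rewrite cl2 root_cluster orbT.
  by rewrite /covers /= => /(_ isT); lia.
- have [qc|qc] := ltnP c q.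
    rewrite (below_s p q); [|lia|lia]; split=> H I HI.
      move: HI; rewrite cl2 => /or3P[/eqP->|/clusters_range|/H//].
        by rewrite /covers /=; lia.
      by rewrite /covers; lia.
    by apply: H; rewrite cl2 HI !orbT.
  split=> H.
  + have hpc : h p = h c by apply/eqP; rewrite eq_le cmax ?H; lia.
    have dp q' : (c < q' < a + k)%N -> below (forest_clusters c.+1 s) p q'.
      move=> qb'; apply/below_s; [lia|lia|] => l Hl.
      by rewrite hpc; apply: cmax; lia.
    move=> I HI; move: (HI); rewrite cl2 => /or3P[/eqP->|/clusters_range|HIs].
    * by rewrite /covers /=; lia.
    * by rewrite /covers; lia.
    move=> Ip; exfalso; apply: (forest_cluster_proper s1 rs HIs).
      by have := dp c.+1 ltac:(lia) I HIs Ip; rewrite /covers; lia.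
    by have := dp (a + k).-1 ltac:(lia) I HIs Ip; rewrite /covers; lia.
  + have unc I : I \in forest_clusters c.+1 s -> ~~ covers I p.
      move=> HI; apply/negP => Ip; have := H I; rewrite cl2 HI !orbT.
      move=> /(_ isT Ip); have := forest_clusters_range HI.
      by rewrite /covers; lia.
    have /below_s : below (forest_clusters c.+1 s) p m.
      by move=> I /unc/negP.
    move=> /(_ ltac:(lia) ltac:(lia) m ltac:(lia)); rewrite hm => hcp l Hl.
    by apply: (le_trans _ hcp); apply: cmax; lia.
- rewrite pc; split=> [_|_]; last exact: cdom.
  move=> I; rewrite cl2 => /or3P[/eqP->|/clusters_range|/forest_clusters_range].
  + by rewrite /covers /=; lia.
  + by rewrite /covers; lia.
  + by rewrite /covers; lia.
Qed.

(** * Cycles of the complete graph *)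

Section Edges.
Variable m : nat.
Local Notation edge := (edge m.+2).
Implicit Types (s : seq 'I_m.+2) (e : edge).

Definition edge01 : edge := exist _ (ord0, ord_max) isT.

(** Total in [i] and [j], so that gaps can be numbered by [nat]; it is the edge
    from [i] to [j] when [i < j < m.+2]. *)
Definition mk_edge (i j : nat) : edge := insubd edge01 (inord i, inord j).

Definition lo e : nat := (\val e).1.
Definition hi e : nat := (\val e).2.
Definition spans e (p : nat) : bool := (lo e <= p < hi e)%N.

Lemma lo_hi e : (lo e < hi e < m.+2)%N.
Proof. by apply/andP; split; [exact: (valP e) | exact: ltn_ord]. Qed.

Lemma val_mk_edge i j : (i < j < m.+2)%N -> val (mk_edge i j) = (inord i, inord j).
Proof. by move=> ij; rewrite /mk_edge insubdK // unfold_in /= !inordK; lia. Qed.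

Lemma lo_mk_edge i j : (i < j < m.+2)%N -> lo (mk_edge i j) = i.
Proof. by move=> ij; rewrite /lo val_mk_edge //= inordK; lia. Qed.

Lemma hi_mk_edge i j : (i < j < m.+2)%N -> hi (mk_edge i j) = j.
Proof. by move=> ij; rewrite /hi val_mk_edge //= inordK; lia. Qed.

Lemma edge_ext e e' : lo e = lo e' -> hi e = hi e' -> e = e'.
Proof.
move=> l h; apply: val_inj; move: l h; rewrite /lo /hi.
by case: (val e) (val e') => [a b] [a' b'] /= /val_inj-> /val_inj->.
Qed.

Lemma edgeE e : e = mk_edge (lo e) (hi e).
Proof.
by have H := lo_hi e; apply: edge_ext; rewrite ?lo_mk_edge ?hi_mk_edge.
Qed.

(** Following the cycle from [x] to [y], the predicate fails for a first time. *)
Lemma cycle_exit s (P : pred 'I_m.+2) x y : uniq s -> x \in s -> y \in s ->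
  P x -> ~~ P y -> exists z, [/\ z \in s, P z & ~~ P (next s z)].
Proof.
move=> us xs ys Px Py; apply: contrapT => noexit.
have step z : z \in s -> P z -> P (next s z).
  by move=> zs Pz; apply: contraT => Pn; case: noexit; exists z.
have := fconnect_cycle (cycle_next us) xs y; rewrite ys => /iter_findex yE.
suff : y \in s /\ P y by case; rewrite (negPf Py).
rewrite -yE; elim: (findex _ _ _) => //= k [ks kP].
by rewrite mem_next ks; split=> //; exact: step.
Qed.

Definition cycle_circuit s : signed_set edge :=
  (forward_edges s, backward_edges s).

(** A cycle that meets both sides of a gap passes it upwards; by the next lemma it
    also passes it downwards. *)
Lemma cycle_forward s (p : nat) (x y : 'I_m.+2) : uniq s -> x \in s -> y \in s ->
  (x <= p < y)%N -> exists2 e, e \in forward_edges s & spans e p.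
Proof.
move=> us xs ys pxy.
have [||z [zs zp nz]] := @cycle_exit s (fun z => z <= p)%N x y us xs ys.
- by lia.
- by lia.
have zn : (z < next s z)%N by lia.
exists (exist _ (z, next s z) zn); last by rewrite /spans /lo /hi /=; lia.
by rewrite inE /= zs eqxx.
Qed.

Lemma cycle_backward s (p : nat) (x y : 'I_m.+2) : uniq s -> x \in s -> y \in s ->
  (x <= p < y)%N -> exists2 e, e \in backward_edges s & spans e p.
Proof.
move=> us xs ys pxy.
have [||z [zs zp nz]] := @cycle_exit s (fun z => p < z)%N y x us ys xs.
- by lia.
- by lia.
have zn : (next s z < z)%N by lia.
exists (exist _ (next s z, z) zn); last by rewrite /spans /lo /hi /=; lia.
by rewrite inE /= zs eqxx.
Qed.

Lemma circuit_ends s e : e \in supp (cycle_circuit s) ->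
  ((\val e).1 \in s) /\ ((\val e).2 \in s).
Proof.
rewrite !inE /= => /orP[] /andP[es /eqP<-]; by rewrite mem_next es.
Qed.

(** An edge used in both directions would close up a cycle of length 2. *)
Lemma circuit_disjoint s e : uniq s -> (2 < size s)%N ->
  e \in forward_edges s -> e \in backward_edges s -> False.
Proof.
move=> us s2; rewrite !inE => /andP[e1 /eqP n1] /andP[e2 /eqP n2].
suff /(uniq_leq_size us) : {subset s <= [:: (val e).1; (val e).2]}.
  by rewrite leqNgt s2.
move=> y ys; apply: contraT => yN.
have [|z [_]] := @cycle_exit s (mem [:: (val e).1; (val e).2]) _ y us e1 ys _ yN.
  exact: mem_head.
by rewrite !inE => /orP[]/eqP->; rewrite ?n1 ?n2 !eqxx ?orbT.
Qed.

Lemma graphical_om_neg C : graphical_om C -> @graphical_om m.+2 (C.2, C.1).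
Proof.
case=> s [us s2 ->]; exists (rev s); rewrite rev_uniq size_rev; split=> //=.
congr pair; apply/setP => e; rewrite !inE mem_rev next_rev //.
- by apply/andP/andP => -[es /eqP<-]; rewrite ?mem_next ?mem_prev ?prev_next ?next_prev.
- by apply/andP/andP => -[es /eqP<-]; rewrite ?mem_next ?mem_prev ?prev_next ?next_prev.
Qed.

Lemma triangle_circuit (i j k : nat) : (i < j)%N -> (j < k)%N -> (k < m.+2)%N ->
  graphical_om ([set mk_edge i j; mk_edge j k], [set mk_edge i k])%SET.
Proof.
move=> ij jk kn; pose s : seq 'I_m.+2 := [:: inord i; inord j; inord k].
have ne (a b : nat) : a != b -> (a < m.+2)%N -> (b < m.+2)%N ->
    (inord a == inord b :> 'I_m.+2) = false.
  by move=> ab am bm; apply/eqP => /(congr1 val); rewrite /= !inordK; lia.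
have us : uniq s by rewrite /= !inE !ne //; lia.
have ni : next s (inord i) = inord j by rewrite /= eqxx.
have nj : next s (inord j) = inord k.
  by rewrite /= ne ?eqxx //; lia.
have nk : next s (inord k) = inord i.
  by rewrite /= (ne k i) ?(ne k j) ?eqxx //; lia.
have sm x : (x \in s) = [|| x == inord i, x == inord j | x == inord k].
  by rewrite !inE.
exists s; split=> //; move: s us ni nj nk sm => s us ni nj nk sm.
congr pair; apply/setP => e; rewrite !inE sm.
- apply/orP/andP.
    by case=> /eqP->; rewrite val_mk_edge /= ?ni ?nj ?eqxx ?orbT //; lia.
  case=> + /eqP nx; have le := lo_hi e; rewrite /lo /hi in le.
  case/or3P => /eqP ex; move: nx; rewrite ex ?ni ?nj ?nk => nx.
  + left; apply/eqP/edge_ext; rewrite ?lo_mk_edge ?hi_mk_edge /lo /hi ?ex -?nx ?inordK //; lia.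
  + right; apply/eqP/edge_ext; rewrite ?lo_mk_edge ?hi_mk_edge /lo /hi ?ex -?nx ?inordK //; lia.
  + by move: le; rewrite ex -nx !inordK; lia.
- apply/eqP/andP.
    by move=> ->; rewrite val_mk_edge /= ?nk ?eqxx ?orbT //; lia.
  case=> + /eqP nx; have le := lo_hi e; rewrite /lo /hi in le.
  case/or3P => /eqP ex; move: nx; rewrite ex ?ni ?nj ?nk => nx.
  + by move: le; rewrite ex -nx !inordK; lia.
  + by move: le; rewrite ex -nx !inordK; lia.
  + by apply/edge_ext; rewrite ?lo_mk_edge ?hi_mk_edge /lo /hi ?ex -?nx ?inordK //; lia.
Qed.

End Edges.

(** * Acyclic initial oriented matroids *)

Section Weights.
Variables (R : realType) (m : nat).
Local Notation edge := (edge m.+2).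
Local Notation M := (@graphical_om m.+2).
Implicit Types (w u v : {ptws edge -> R}) (s : seq 'I_m.+2) (e : edge).

Definition gap w (p : nat) : R := w (mk_edge m p p.+1).

(** The order-compatible ultrametrics, as weights that are maxima of gap weights.
    Attaining the maximum at a gap is what later proofs use. *)
Definition ultra w : Prop := forall e,
  (exists2 p, spans e p & w e = gap w p) /\
  (forall p, spans e p -> gap w p <= w e).

Lemma in_max_weight w (A : {set edge}) e :
  reflect (e \in A /\ forall f, f \in A -> w f <= w e) (e \in max_weight w A).
Proof.
rewrite !inE; apply: (iffP andP) => -[eA H]; split=> //.
  by move=> f fA; move/forallP/(_ f)/implyP: H; apply.
by apply/forallP => f; apply/implyP; exact: H.
Qed.

Lemma max_weight_neq0 w (A : {set edge}) e : e \in A ->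
  exists f, f \in max_weight w A.
Proof.
move=> eA; case: (@Order.TotalTheory.arg_maxP _ _ _ e (mem A) w eA) => f fA H.
by exists f; apply/in_max_weight; split=> // g gA; exact: H.
Qed.

Lemma supp_initial w C : supp (initial w C) = max_weight w (supp C).
Proof.
rewrite /supp /= -finset.setIUl; apply/finset.setIidPr/fintype.subsetP => e /in_max_weight[].
by rewrite /supp.
Qed.

Lemma circuit_supp_neq0 C : M C -> exists e, e \in supp C.
Proof.
case=> s [us s2 ->]; case: s us s2 => [//|x [//|y s]] us _.
have xs : x \in [:: x, y & s] by rewrite inE eqxx.
have ys : y \in [:: x, y & s] by rewrite !inE eqxx orbT.
have xy : x != y by move: us => /= /andP[]; rewrite !inE negb_or => /andP[].
have [lt|] := ltnP x y.
  have [|e He _] := @cycle_forward _ _ x x y us xs ys; first by lia.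
  by exists e; rewrite inE He.
rewrite leq_eqVlt => /predU1P[/val_inj e|lt]; first by rewrite e eqxx in xy.
have [|e He _] := @cycle_forward _ _ y y x us ys xs; first by lia.
by exists e; rewrite inE He.
Qed.

Lemma initial_supp_neq0 w C : M C -> exists e, e \in supp (initial w C).
Proof.
by move=> /circuit_supp_neq0[e /(max_weight_neq0 w)]; rewrite supp_initial.
Qed.

(** Both crossings of the gap [p] weigh at least [gap w p], so they belong to the
    initial form as soon as no edge of the cycle is heavier. *)
Lemma gap_crossing w s (p : nat) (x y : 'I_m.+2) : ultra w -> uniq s ->
  x \in s -> y \in s -> (x <= p < y)%N ->
  (forall e, e \in supp (cycle_circuit s) -> w e <= gap w p) ->
  (exists2 e, e \in (initial w (cycle_circuit s)).1 & spans e p) /\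
  (exists2 e, e \in (initial w (cycle_circuit s)).2 & spans e p).
Proof.
move=> uw us xs ys pxy wmax; split.
  have [e es ep] := cycle_forward us xs ys pxy; exists e => //.
  rewrite finset.in_setI es; apply/in_max_weight; split=> [|f /wmax].
    by rewrite inE es.
  by move/le_trans; apply; apply: (uw e).2.
have [e es ep] := cycle_backward us xs ys pxy; exists e => //.
rewrite finset.in_setI es; apply/in_max_weight; split=> [|f /wmax].
  by rewrite inE es orbT.
by move/le_trans; apply; apply: (uw e).2.
Qed.

Lemma separated_ends s e f (p : nat) :
  e \in supp (cycle_circuit s) -> f \in supp (cycle_circuit s) ->
  (minn (lo e) (lo f) <= p < maxn (hi e) (hi f))%N ->
  exists a b : 'I_m.+2, [/\ a \in s, b \in s & (a <= p < b)%N].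
Proof.
move=> /circuit_ends[e1 e2] /circuit_ends[f1 f2] /andP[].
rewrite geq_min ltnNge geq_max negb_and -!ltnNge.
have ends (a b : 'I_m.+2) : a \in s -> b \in s -> (a <= p)%N -> (p < b)%N ->
    exists a b : 'I_m.+2, [/\ a \in s, b \in s & (a <= p < b)%N].
  by move=> sa sb ap pb; exists a, b; split; rewrite ?ap.
by move=> /orP[ap|ap] /orP[pb|pb];
  [exact: ends e1 e2 ap pb | exact: ends e1 f2 ap pb
  |exact: ends f1 e2 ap pb | exact: ends f1 f2 ap pb].
Qed.

Lemma initial_both_signs w C : ultra w -> M C ->
  (exists e, e \in (initial w C).1) /\ (exists e, e \in (initial w C).2).
Proof.
move=> uw MC; have [e] := circuit_supp_neq0 MC; case: MC => s [us s2 ->].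
move=> /(max_weight_neq0 w)[f /in_max_weight[fC fmax]].
have [[p fp wf] _] := uw f.
have [f1 f2] := circuit_ends fC.
have [||[e1 H1 _] [e2 H2 _]] := @gap_crossing w s p _ _ uw us f1 f2.
- exact: fp.
- by move=> g gC; rewrite -wf; apply: fmax.
by split; [exists e1|exists e2].
Qed.

Lemma initial_neg w (C : signed_set edge) :
  initial w (C.2, C.1) = ((initial w C).2, (initial w C).1).
Proof. by rewrite /initial /supp /= finset.setUC. Qed.

Lemma initial_disjoint w C e : M C ->
  e \in (initial w C).1 -> e \in (initial w C).2 -> False.
Proof.
case=> s [us s2 ->]; rewrite !finset.in_setI => /andP[e1 _] /andP[e2 _].
exact: circuit_disjoint e1 e2.
Qed.

Lemma ultra_acyclic w : ultra w -> acyclic (initial_om M w).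
Proof.
move=> uw [_ [[C MC <-] _] C2].
by have [_ [e]] := initial_both_signs uw MC; rewrite C2 inE.
Qed.

(** A one-element initial form is a minimal one, and it or its negative is
    positive. *)
Lemma acyclic_supp_gt1 w C : acyclic (initial_om M w) -> M C ->
  (1 < #|supp (initial w C)|)%N.
Proof.
move=> acy MC; rewrite ltnNge; apply/negP => small.
have minD C' : M C' -> supp (initial w C') = supp (initial w C) ->
    initial_om M w (initial w C').
  move=> MC' eC'; split; first by exists C'.
  move=> _ [B MB <-]; rewrite eC'; apply/negP => /proper_card lt.
  have [e eB] := initial_supp_neq0 w MB.
  have : (0 < #|supp (initial w B)|)%N by apply/card_gt0P; exists e.
  by rewrite ltnNge -ltnS (leq_trans lt small).
have [e eC] := initial_supp_neq0 w MC.
have eqe f : f \in supp (initial w C) -> f = e.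
  by move=> fC; move/card_le1P: small => /(_ e eC f); rewrite fC inE => /esym/eqP.
have [e1|e1] := boolP (e \in (initial w C).1).
  apply: acy; exists (initial w C); first exact: minD.
  apply/setP => f; rewrite [RHS]inE; apply/negP => f2.
  have fe : f = e by apply: eqe; rewrite inE f2 orbT.
  by rewrite fe in f2; exact: (initial_disjoint MC e1 f2).
apply: acy; exists (initial w (C.2, C.1)).
  apply: minD; first exact: graphical_om_neg.
  by rewrite initial_neg /supp /= finset.setUC.
rewrite initial_neg /=; apply/setP => f; rewrite [RHS]inE; apply/negP => f1.
have fe : f = e by apply: eqe; rewrite inE f1.
by rewrite -fe f1 in e1.
Qed.

(** An initial form on at most two elements is minimal, because the smaller ones
    are excluded by [acyclic_supp_gt1]. *)
Lemma acyclic_neg_neq0 w C : acyclic (initial_om M w) -> M C ->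
  (#|supp (initial w C)| <= 2)%N -> (initial w C).2 != finset.set0.
Proof.
move=> acy MC small; apply/eqP => C2; apply: (acy); exists (initial w C) => //.
split; first by exists C.
move=> _ [B MB <-]; apply/negP => /proper_card lt.
by have := acyclic_supp_gt1 acy MB; rewrite ltnNge -ltnS (leq_trans lt small).
Qed.

(** The triangle has two positive edges [ij], [jk] and one negative edge [ik].  If
    [ik] were not maximal, the initial form would be positive with at most two
    elements; if only [ik] were maximal, it would have a single element. *)
Lemma acyclic_triangle w (i j k : nat) : acyclic (initial_om M w) ->
  (i < j)%N -> (j < k)%N -> (k < m.+2)%N ->
  [/\ w (mk_edge m i j) <= w (mk_edge m i k),
      w (mk_edge m j k) <= w (mk_edge m i k)
    & w (mk_edge m i k) = w (mk_edge m i j) \/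
      w (mk_edge m i k) = w (mk_edge m j k)].
Proof.
move=> acy ij jk kn; have MC := triangle_circuit ij jk kn.
set eij := mk_edge m i j in MC *; set ejk := mk_edge m j k in MC *.
set eik := mk_edge m i k in MC *; set C := (_, _) in MC.
have inC f : (f \in supp C) = [|| f == eij, f == ejk | f == eik].
  by rewrite !inE -orbA.
have ikmax : eik \in max_weight w (supp C).
  apply: contraT => ikN.
  have C20 : (initial w C).2 = finset.set0.
    apply/setP => f; rewrite finset.in_setI [RHS]inE inE.
    by case: eqP => //= ->; apply: negbTE.
  suff /(acyclic_neg_neq0 acy MC) : (#|supp (initial w C)| <= 2)%N by rewrite C20 eqxx.
  apply: leq_trans (_ : #|[set eij; ejk]%SET| <= 2)%N; last first.
    by rewrite cards2; case: (_ != _).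
  apply/subset_leq_card/fintype.subsetP => f; rewrite supp_initial => fmax.
  have /in_max_weight[] := fmax; rewrite inC => /or3P[] fE _.
  - by rewrite !inE fE.
  - by rewrite !inE fE orbT.
  - by rewrite (eqP fE) (negPf ikN) in fmax.
have /in_max_weight[_ H] := ikmax.
have lij : w eij <= w eik by apply: H; rewrite inC eqxx.
have ljk : w ejk <= w eik by apply: H; rewrite inC eqxx orbT.
split=> //; apply: contrapT => /not_orP[nij njk].
have := acyclic_supp_gt1 acy MC; rewrite ltnNge => /negP; apply.
rewrite -(cards1 eik); apply/subset_leq_card/fintype.subsetP => f.
rewrite supp_initial inE => /in_max_weight[].
rewrite inC => /or3P[] /eqP-> /(_ eik); rewrite ?inE ?eqxx ?orbT => /(_ isT) //.
- by move=> le; case: nij; apply/le_anti; rewrite le lij.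
- by move=> le; case: njk; apply/le_anti; rewrite le ljk.
Qed.

Lemma acyclic_ultra w : acyclic (initial_om M w) -> ultra w.
Proof.
move=> acy e; rewrite (edgeE e); move: (lo_hi e).
move: (lo e) (hi e) => {e} i j /andP[].
elim: j => // j IH; rewrite ltnS leq_eqVlt => /predU1P[-> jn|ij jn].
  split.
    by exists j => //; rewrite /spans lo_mk_edge ?hi_mk_edge //; lia.
  move=> p; rewrite /spans lo_mk_edge ?hi_mk_edge; [|lia|lia].
  by move=> H; have -> : p = j by lia.
have [[p ep wp] H] := IH ij (ltnW jn).
have [le1 le2 eqs] := acyclic_triangle acy ij (ltnSn j) jn.
rewrite /spans lo_mk_edge ?hi_mk_edge in ep; [|lia|lia].
split.
- case: eqs => [->|->]; rewrite /spans lo_mk_edge ?hi_mk_edge; [|lia|lia| |lia|lia].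
    by exists p => //; lia.
  by exists j => //; lia.
- move=> q; rewrite /spans lo_mk_edge ?hi_mk_edge; [|lia|lia] => qij.
  have [->//|qj] := eqVneq q j.
  by apply: le_trans le1; apply: H; rewrite /spans lo_mk_edge ?hi_mk_edge; lia.
Qed.

(** The initial form with the two edges [e1], [e2] has minimal support, so it is
    also the initial form at [v] of some cycle through both edges.  Were the gap
    [p] at least as heavy as these edges for [v], a positive edge of that initial
    form would cross [p]; but [e1] is the only positive one. *)
Lemma ultra_pair_gap u v C e1 e2 (p : nat) : ultra u -> ultra v ->
  initial_om M u = initial_om M v -> M C ->
  initial u C = ([set e1], [set e2])%SET -> ~~ spans e1 p ->
  (minn (lo e1) (lo e2) <= p < maxn (hi e1) (hi e2))%N ->
  gap v p < v e2.
Proof.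
move=> uu uv eM MC iC pe1 pe.
have : initial_om M v ([set e1], [set e2])%SET.
  rewrite -eM; split; first by exists C.
  move=> _ [B MB <-]; apply/negP => /proper_card.
  apply/negP; rewrite -leqNgt.
  have [[f1 H1] [f2 H2]] := initial_both_signs uu MB.
  have f12 : f1 != f2.
    by apply/eqP => f12; rewrite -f12 in H2; exact: (initial_disjoint MB H1 H2).
  apply: (@leq_trans 2); first by rewrite /supp cards2; case: (_ != _).
  apply: (@leq_trans #|[set f1; f2]%SET|); first by rewrite cards2 f12.
  by apply/subset_leq_card/fintype.subsetP => f; rewrite in_set2 => /orP[]/eqP->;
    rewrite /supp finset.in_setU ?H1 ?H2 ?orbT.
move=> [[_ [s [us s2 ->]] iv] _].
have inv1 : e1 \in (initial v (cycle_circuit s)).1 by rewrite iv inE.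
have inv2 : e2 \in (initial v (cycle_circuit s)).2 by rewrite iv inE.
have c1 : e1 \in supp (cycle_circuit s) by move: inv1; rewrite finset.in_setI => /andP[]; rewrite /supp finset.in_setU => ->.
have c2 : e2 \in supp (cycle_circuit s) by move: inv2; rewrite finset.in_setI => /andP[]; rewrite /supp finset.in_setU orbC => ->.
have /in_max_weight[_ vmax] : e2 \in max_weight v (supp (cycle_circuit s)).
  by move: inv2; rewrite finset.in_setI => /andP[].
rewrite ltNge; apply/negP => le.
have [a [b [as_ bs ab]]] := separated_ends c1 c2 pe.
have [|[e + ep] _] := @gap_crossing v s p a b uv us as_ bs ab.
  by move=> f fC; apply: le_trans le; apply: vmax.
by rewrite [initial _ _]iv inE => /eqP ee; rewrite -ee ep in pe1.
Qed.

Lemma initial_two_edges w e0 e1 e2 : w e0 < w e1 -> w e2 = w e1 -> e1 != e2 ->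
  initial w ([set e1; e0], [set e2])%SET = ([set e1], [set e2])%SET.
Proof.
move=> lt1 e21 n12; set C := (_, _).
have n01 : e0 != e1 by apply: contraTneq lt1 => ->; rewrite ltxx.
have n02 : e0 != e2 by apply: contraTneq lt1 => ->; rewrite e21 ltxx.
have mx : max_weight w (supp C) = [set e1; e2]%SET.
  apply/setP => f; apply/in_max_weight/idP; rewrite !inE.
    move=> [/orP[/orP[->//|/eqP->]|->]]; rewrite ?orbT // => /(_ e1).
    by rewrite !inE eqxx leNgt lt1 => /(_ isT).
  move=> fE; split; first by case/orP: fE => ->; rewrite ?orbT.
  have -> : w f = w e1 by case/orP: fE => /eqP->.
  move=> g; rewrite !inE => /orP[/orP[]|] /eqP->; rewrite ?e21 //.
  exact: ltW.
rewrite /initial mx; congr pair; apply/setP => f; rewrite !inE.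
  have [->|] := eqVneq f e1; first by [].
  by have [->|] := eqVneq f e0; rewrite ?(negPf n02).
by have [->|] := eqVneq f e2; rewrite ?orbT.
Qed.

(** In the triangle, [e1] and [e2] join the two ends of the gap [p] to a common
    vertex; [e2] is the longer one. *)
Lemma two_edges_dominates u v e1 e2 (p l : nat) : ultra u -> ultra v ->
  initial_om M u = initial_om M v ->
  M ([set e1; mk_edge m p p.+1], [set e2])%SET ->
  (forall p', spans e2 p' = spans e1 p' || (p' == p)) -> ~~ spans e1 p ->
  spans e1 l -> gap u p < gap u l ->
  exists2 p', spans e2 p' & gap v p < gap v p'.
Proof.
move=> uu uv eM MC sp ps ls ult.
have lt1 : gap u p < u e1 by apply: lt_le_trans ult _; exact: (uu e1).2.
have eqs : u e2 = u e1.
  apply/le_anti/andP; split.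
    have [[p' + ->] _] := uu e2; rewrite sp => /orP[|/eqP->]; last exact: ltW.
    exact: (uu e1).2.
  have [[p' e1p ->] _] := uu e1; apply: (uu e2).2.
  by rewrite sp e1p.
have n12 : e1 != e2.
  by apply/eqP => e12; move: (sp p); rewrite e12 eqxx orbT -e12 (negPf ps).
have vlt : gap v p < v e2.
  apply: (ultra_pair_gap uu uv eM MC (initial_two_edges _ _ _)) => //.
  have := sp p; rewrite eqxx orbT /spans; lia.
by have [[p' e2p' vp'] _] := uv e2; exists p'; rewrite -?vp'.
Qed.

(** If a gap [l] beats [p] for [u], the triangle on [p], [p.+1] and the vertex just
    beyond [l] has a two-element initial form, and its presence at [v] produces a
    gap that beats [p] for [v], no farther from [p] than [l]. *)
Lemma initial_om_dominates u v (p q : nat) : ultra u -> ultra v ->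
  initial_om M u = initial_om M v -> (p < m.+1)%N -> (q < m.+1)%N ->
  dominates (gap v) p q -> dominates (gap u) p q.
Proof.
move=> uu uv eM pm qm dv l pql; rewrite leNgt; apply/negP => ult.
have [lp|pl|pl] := ltngtP l p; last by rewrite pl ltxx in ult.
- have MC := triangle_circuit lp (ltnSn p) pm.
  have [|||p'] := two_edges_dominates uu uv eM MC _ _ _ ult.
  + by move=> p'; rewrite /spans !lo_mk_edge ?hi_mk_edge; lia.
  + by rewrite /spans !lo_mk_edge ?hi_mk_edge; lia.
  + by rewrite /spans !lo_mk_edge ?hi_mk_edge; lia.
  rewrite /spans !lo_mk_edge ?hi_mk_edge; [|lia|lia] => Hp'.
  by rewrite ltNge dv //; lia.
- have lm : (l.+1 < m.+2)%N by lia.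
  have := triangle_circuit (ltnSn p) (pl : p.+1 < l.+1)%N lm.
  rewrite finset.setUC => MC.
  have [|||p'] := two_edges_dominates uu uv eM MC _ _ _ ult.
  + by move=> p'; rewrite /spans !lo_mk_edge ?hi_mk_edge; lia.
  + by rewrite /spans !lo_mk_edge ?hi_mk_edge; lia.
  + by rewrite /spans !lo_mk_edge ?hi_mk_edge; lia.
  rewrite /spans !lo_mk_edge ?hi_mk_edge; [|lia|lia] => Hp'.
  by rewrite ltNge dv //; lia.
Qed.

(** An edge is maximal in a cycle exactly when some gap under it dominates all the
    gaps under the edges of the cycle; the gaps between these are crossed by the
    cycle too, which is why domination, and not only an inequality, holds. *)
Lemma max_weight_dominates u v C : ultra u -> ultra v -> M C ->
  (forall p q, (p < m.+1)%N -> (q < m.+1)%N ->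
     dominates (gap u) p q -> dominates (gap v) p q) ->
  max_weight u (supp C) \subset max_weight v (supp C).
Proof.
move=> uu uv [s [us s2 ->]] D; apply/fintype.subsetP => e /in_max_weight[eC emax].
apply/in_max_weight; split=> // f fC.
have [[p ep ue] _] := uu e; have [[q fq ->] _] := uv f.
have pe := (uv e).2 p ep; apply: le_trans pe.
have := lo_hi e; have := lo_hi f => bf be.
apply: (D p q); [by move: ep; rewrite /spans; lia|by move: fq; rewrite /spans; lia| |lia].
move=> l pql; rewrite -ue.
have [a [b [as_ bs ab]]] : exists a b, [/\ a \in s, b \in s & (a <= l < b)%N].
  apply: separated_ends eC fC _; move: pql ep fq; rewrite /spans; clear; lia.
have [g gs gl] := cycle_forward us as_ bs ab.
by apply: le_trans ((uu g).2 l gl) (emax g _); rewrite inE gs.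
Qed.

Lemma dominates_initial_om u v : ultra u -> ultra v ->
  (forall p q, (p < m.+1)%N -> (q < m.+1)%N ->
     dominates (gap u) p q <-> dominates (gap v) p q) ->
  initial_om M u = initial_om M v.
Proof.
move=> uu uv D.
have ini C : M C -> initial u C = initial v C.
  move=> MC; rewrite /initial.
  suff -> : max_weight u (supp C) = max_weight v (supp C) by [].
  apply/eqP; rewrite finset.eqEsubset !max_weight_dominates // => p q pm qm /D; exact.
rewrite /initial_om; suff -> : (initial u @` M = initial v @` M)%classic by [].
by apply/seteqP; split=> _ [C MC <-]; exists C => //; rewrite ini.
Qed.

End Weights.

Local Open Scope classical_set_scope.

(** * Closures of cells *)

(** Pointwise convergence for a domain without topology. *)
Lemma ptws_cvg (E : eqType) (V : topologicalType) (F : set_system {ptws E -> V})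
    (f : {ptws E -> V}) : Filter F ->
  (forall e, (fun g : {ptws E -> V} => g e) @ F --> f e) -> F --> f.
Proof.
move=> FF H; apply/cvg_sup => e; apply/cvg_image.
  by rewrite eqEsubset; split=> v // _; exists (fun=> v).
move=> W /H FW; exists ((fun g : {ptws E -> V} => g e) @^-1` W) => //.
by rewrite eqEsubset; split=> [v [g Wg <-]//|v Wv]; exists (fun=> v).
Qed.

Lemma ptws_eval_continuous (E : eqType) (V : topologicalType) (e : E) :
  continuous (fun g : {ptws E -> V} => g e).
Proof. exact: (@proj_continuous E (fun=> V) e). Qed.

Section Comonotone.
Variables (R : realType) (m : nat).
Local Notation edge := (edge m.+2).
Local Notation M := (@graphical_om m.+2).
Implicit Types (f g h : nat -> R) (u v w : {ptws edge -> R}).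

Lemma dominates_affine (a b : R) f p q : 0 < a ->
  dominates (fun l => a * f l + b) p q <-> dominates f p q.
Proof.
by move=> a0; split=> H l /H; rewrite lerD2r ler_pM2l.
Qed.

Lemma ultra_affine (a b : R) w : 0 < a -> ultra w -> ultra (fun e => a * w e + b).
Proof.
move=> a0 uw e; have [[p ep we] H] := uw e; split.
  by exists p; rewrite // /gap we.
by move=> q /H le; rewrite /gap lerD2r ler_pM2l.
Qed.

(** If [p] does not dominate [q] for [g], the maximum [c] of [g] between them
    strictly beats [p] for [g]; as [c] dominates [p] for [g], it does so weakly for
    [f], hence strictly for the combination. *)
Lemma dominates_mix (eps : R) f g p q : 0 < eps ->
  (p < m.+1)%N -> (q < m.+1)%N ->
  (forall p q, (p < m.+1)%N -> (q < m.+1)%N -> dominates g p q -> dominates f p q) ->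
  dominates (fun l => f l + eps * g l) p q <-> dominates g p q.
Proof.
move=> e0 pm qm sub; split=> [H|gpq l pql]; last first.
  by rewrite lerD ?ler_pM2l //; [apply: (sub p q)|apply: gpq].
have [|c [cb cmax _]] := @exists_leftmost_max R g (minn p q) (maxn p q).+1; first by lia.
suff gpc : g c <= g p.
  by move=> l pql; apply: le_trans gpc; apply: cmax; lia.
rewrite leNgt; apply/negP => gpc.
have gcp : dominates g c p by move=> l Hl; apply: cmax; lia.
have fpc : f p <= f c by apply: (sub c p _ _ gcp); lia.
have := H c ltac:(lia); rewrite leNgt => /negP; apply.
by rewrite ler_ltD // ltr_pM2l.
Qed.

(** A gap attaining the maximum over an edge for [v] also attains it for [u], so
    the two maxima add up. *)
Lemma ultra_mix (eps : R) u v : 0 < eps -> ultra u -> ultra v ->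
  (forall p q, (p < m.+1)%N -> (q < m.+1)%N ->
     dominates (gap v) p q -> dominates (gap u) p q) ->
  ultra (fun e => u e + eps * v e).
Proof.
move=> e0 uu uv sub e; have [[p ep ve] vmax] := uv e.
have [[p0 ep0 ue] umax] := uu e; split; last first.
  by move=> q eq; rewrite /gap lerD ?ler_pM2l //; [exact: umax|exact: vmax].
exists p => //; rewrite ve /gap; congr (_ + _); apply/le_anti.
have := lo_hi e; rewrite /spans in ep ep0 vmax => be.
rewrite umax // andbT ue; apply: (sub p p0); [lia|lia| |lia].
by move=> l Hl; rewrite -ve; apply: vmax; lia.
Qed.

Lemma constant_gaps w : ultra w ->
  (forall p q, (p < m.+1)%N -> (q < m.+1)%N -> dominates (gap w) p q) ->
  forall e, w e = gap w 0.
Proof.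
move=> uw D e; have [[p ep ->] _] := uw e.
have := lo_hi e; rewrite /spans in ep => be.
by apply/le_anti; rewrite (D 0%N p) ?(D p 0%N) //; lia.
Qed.

(** Full domination makes the weight constant, and the sphere excludes constants. *)
Lemma sphere_gaps w : weight_sphere w -> ultra w ->
  ~ (forall p q, (p < m.+1)%N -> (q < m.+1)%N -> dominates (gap w) p q).
Proof.
move=> [s0 s1] uw /(constant_gaps uw) cw; move: s0 s1.
under eq_bigr do rewrite cw; under [X in _ -> X = _ -> _]eq_bigr do rewrite cw.
rewrite !sumr_const => /eqP; rewrite mulrn_eq0 => /orP[/eqP c0|/eqP->].
  by have := card0_eq c0 (edge01 m).
by rewrite expr0n /= mul0rn => /esym/eqP; rewrite oner_eq0.
Qed.

Lemma in_bergman w : positive_bergman M w <-> weight_sphere w /\ ultra w.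
Proof.
split=> -[sw H]; split=> //; first exact: acyclic_ultra.
exact: ultra_acyclic.
Qed.

Lemma in_coarse_class w v : positive_bergman M w ->
  coarse_class M w v <->
  [/\ weight_sphere v, ultra v & forall p q, (p < m.+1)%N -> (q < m.+1)%N ->
     dominates (gap v) p q <-> dominates (gap w) p q].
Proof.
move=> /in_bergman[sw uw]; split.
  move=> [/in_bergman[sv uv] eM]; split=> // p q pm qm.
  by split; apply: initial_om_dominates.
move=> [sv uv D]; split; first exact/in_bergman.
exact: dominates_initial_om.
Qed.

Lemma exists_weight h : exists w, ultra w /\
  forall p, (p < m.+1)%N -> gap w p = h p.
Proof.
have /choice[c cP] : forall e : edge, exists c, spans e c /\
    forall p, spans e p -> h p <= h c.
  move=> e; have [|c [ec cmax _]] := @exists_leftmost_max R h (lo e) (hi e).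
    by have := lo_hi e; lia.
  by exists c.
have gapE p : (p < m.+1)%N -> h (c (mk_edge m p p.+1)) = h p.
  move=> pm; have [+ _] := cP (mk_edge m p p.+1).
  rewrite /spans lo_mk_edge ?hi_mk_edge; [|lia|lia] => H.
  by congr h; lia.
exists (fun e => h (c e)); split=> // e; have [ec cmax] := cP e.
have be := lo_hi e; split=> [|p ep].
  by exists (c e); rewrite // /gap gapE //; move: ec; rewrite /spans; lia.
by rewrite /gap gapE; [exact: cmax | move: ep; rewrite /spans; lia].
Qed.

(** The weight obtained from [h] is moved to the sphere by subtracting its mean
    [mu] and dividing by the square root of [s2]; [s2] vanishes only for constant
    weights. *)
Lemma exists_bergman h :
  ~ (forall p q, (p < m.+1)%N -> (q < m.+1)%N -> dominates h p q) ->
  exists w, [/\ weight_sphere w, ultra w & forall p q,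
    (p < m.+1)%N -> (q < m.+1)%N -> dominates (gap w) p q <-> dominates h p q].
Proof.
move=> nD; have [w [uw wh]] := exists_weight h.
pose mu := (\sum_e w e) / #|{: edge}|%:R.
pose s2 := \sum_e (w e - mu) ^+ 2.
have N0 : #|{: edge}|%:R != 0 :> R.
  rewrite pnatr_eq0 -lt0n; apply/card_gt0P; exists (edge01 m); exact: isT.
have Dw p q : (p < m.+1)%N -> (q < m.+1)%N ->
    dominates (gap w) p q <-> dominates h p q.
  by move=> pm qm; split=> H l Hl; have := H l Hl; rewrite !wh //; lia.
have s2ge0 : 0 <= s2 by apply: sumr_ge0 => e _; exact: sqr_ge0.
have s2gt0 : 0 < s2.
  rewrite lt_def s2ge0 andbT; apply/eqP => s20; apply: nD => p q pm qm.
  have cw e : w e = mu.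
    move/eqP: s20; rewrite psumr_eq0 => [/allP/(_ e (mem_index_enum e))|? _].
      by rewrite sqrf_eq0 subr_eq0 => /eqP.
    exact: sqr_ge0.
  by apply/Dw => // l _; rewrite /gap !cw.
pose a := (Num.sqrt s2)^-1.
have a0 : 0 < a by rewrite invr_gt0 sqrtr_gt0.
have a2 : a ^+ 2 * s2 = 1 by rewrite exprVn sqr_sqrtr // mulVf // gt_eqF.
exists (fun e => a * w e + (- a * mu)); split.
- split.
    rewrite big_split /= -mulr_sumr sumr_const -mulr_natr /mu.
    by rewrite -!mulrA mulVf // mulr1 mulNr subrr.
  rewrite -[RHS]a2 /s2 mulr_sumr; apply: eq_bigr => e _.
  by rewrite mulNr -mulrBr exprMn.
- exact: ultra_affine.
- move=> p q pm qm; rewrite -Dw // -(dominates_affine (- a * mu) (gap w) p q a0).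
  by [].
Qed.

Lemma sphere_path_norm u v (eps : R) : weight_sphere u -> weight_sphere v ->
  \sum_e (u e + eps * v e) ^+ 2 =
  1 + eps * (2 * \sum_e u e * v e) + eps ^+ 2.
Proof.
move=> [_ u2] [_ v2].
transitivity (\sum_e u e ^+ 2 + eps * (2 * \sum_e u e * v e) +
              eps ^+ 2 * \sum_e v e ^+ 2); last by rewrite u2 v2 mulr1.
rewrite !mulr_sumr -!big_split /=; apply: eq_bigr => e _.
by ring.
Qed.

(** The approximating points are [u + eps v], rescaled to the sphere. *)
Lemma comonotone_closure u v (B : set {ptws edge -> R}) :
  weight_sphere u -> weight_sphere v -> ultra u -> ultra v ->
  (forall p q, (p < m.+1)%N -> (q < m.+1)%N ->
     dominates (gap v) p q -> dominates (gap u) p q) ->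
  nbhs u B -> exists z, [/\ B z, weight_sphere z, ultra z &
    forall p q, (p < m.+1)%N -> (q < m.+1)%N ->
      dominates (gap z) p q <-> dominates (gap v) p q].
Proof.
move=> su sv uu uv sub Bu.
pose N2 (eps : R) := \sum_e (u e + eps * v e) ^+ 2.
pose z (eps : R) : {ptws edge -> R} :=
  fun e => (Num.sqrt (N2 eps))^-1 * (u e + eps * v e) + 0.
have eps_to0 : (fun eps : R => eps) @ 0^'+ --> (0 : R) by exact: cvg_at_right_filter.
have cN2 : N2 eps @[eps --> 0^'+] --> (1 : R).
  rewrite /N2; under eq_fun do rewrite sphere_path_norm //.
  have c : 1 + eps * (2 * \sum_e u e * v e) + eps * eps @[eps --> 0^'+] -->
      (1 + 0 * (2 * \sum_e u e * v e) + 0 * 0 : R).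
    by apply: cvgD; [apply: cvgD; [exact: cvg_cst|exact: cvgMl]|exact: cvgM].
  rewrite !mul0r !addr0 in c; under eq_fun do rewrite expr2; exact: c.
have cz : z eps @[eps --> 0^'+] --> u.
  apply: ptws_cvg => e.
  have -> : u e = (Num.sqrt 1)^-1 * (u e + 0 * v e) + 0.
    by rewrite sqrtr1 invr1 mul1r mul0r !addr0.
  apply: cvgD; last exact: cvg_cst.
  apply: cvgM.
    apply: cvgV; first by rewrite sqrtr1 oner_eq0.
    by apply: continuous_cvg cN2; exact: sqrt_continuous.
  by apply: cvgD; [exact: cvg_cst|apply: cvgMl].
have [eps [Bz eps0 N20]] : exists eps : R, [/\ B (z eps), 0 < eps & 0 < N2 eps].
  near (0 : R)^'+ => eps; exists eps; split.
  - by near: eps; exact: cz.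
  - by near: eps; exact: nbhs_right_gt.
  - by near: eps; apply: (cvgr_gt 1 cN2); exact: ltr01.
have a0 : 0 < (Num.sqrt (N2 eps))^-1 by rewrite invr_gt0 sqrtr_gt0.
exists (z eps); split=> //.
- split.
    rewrite big_split /= sumr_const mul0rn addr0 -mulr_sumr big_split /=.
    by rewrite su.1 -mulr_sumr sv.1 mulr0 addr0 mulr0.
  rewrite /z; under eq_bigr do rewrite addr0 exprMn.
  by rewrite -mulr_sumr exprVn sqr_sqrtr ?ltW // mulVf // gt_eqF.
- by apply: ultra_affine => //; exact: ultra_mix.
- move=> p q pm qm; rewrite -(dominates_mix eps0 pm qm sub).
  exact: (dominates_affine 0 _ p q a0).
Unshelve. all: by end_near.
Qed.

Local Notation cell := (coarse_cells (R := R) M).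

(** * Cells and trees *)

(** All points of a nonempty cell have the same domination relation; quantifying
    over them gives the full relation for the empty cell, as wanted. *)
Definition cell_dominates (c : cell) (p q : nat) : Prop :=
  forall w, \val c w -> dominates (gap w) p q.

Lemma cellP (c : cell) :
  \val c = set0 \/ exists2 w, positive_bergman M w & \val c = coarse_class M w.
Proof.
by case: (set_valP c) => [|[w Bw <-]]; [left|right; exists w].
Qed.

Lemma class_dominates (c : cell) w p q : positive_bergman M w ->
  \val c = coarse_class M w -> (p < m.+1)%N -> (q < m.+1)%N ->
  cell_dominates c p q <-> dominates (gap w) p q.
Proof.
move=> Bw cw pm qm; split=> [H|H v]; first by apply: H; rewrite cw.
by rewrite cw => /(in_coarse_class _ Bw)[_ _ ->].
Qed.

Lemma empty_cell_dominates (c : cell) :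
  (forall p q, (p < m.+1)%N -> (q < m.+1)%N -> cell_dominates c p q) ->
  \val c = set0.
Proof.
move=> H; case: (cellP c) => [//|[w Bw cw]].
have /in_bergman[sw uw] := Bw.
case: (sphere_gaps sw uw) => p q pm qm.
exact/(class_dominates Bw cw pm qm)/H.
Qed.

Lemma cell_leP (c d : cell) : cell_le c d <->
  forall p q, (p < m.+1)%N -> (q < m.+1)%N ->
    cell_dominates d p q -> cell_dominates c p q.
Proof.
split=> [le p q _ _ H w cw l pql|H].
  rewrite leNgt; apply/negP => wpl.
  have /le/(_ [set v | gap v p < gap v l])[] := subset_closure cw.
    have cgap : (fun v : {ptws edge -> R} => gap v l - gap v p) @ w --> gap w l - gap w p.
      exact: (cvgB (@ptws_eval_continuous edge R (mk_edge m l l.+1) w)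
                   (@ptws_eval_continuous edge R (mk_edge m p p.+1) w)).
    have : \forall v \near w, 0 < gap v l - gap v p.
      by apply: (cvgr_gt _ cgap); rewrite subr_gt0.
    by apply: filterS => v; rewrite /= subr_gt0.
  by move=> v [/H/(_ l pql) + /= vpl]; rewrite leNgt vpl.
rewrite /cell_le closureE; apply: smallest_sub; first exact: closed_closure.
move=> w cw B Bw.
case: (cellP c) => [c0|[w0 Bw0 cw0]]; first by rewrite c0 in cw.
have /(in_coarse_class _ Bw0)[sw uw Dw] : coarse_class M w0 w by rewrite -cw0.
case: (cellP d) => [d0|[v Bv dv]].
  have /empty_cell_dominates c0 : forall p q, (p < m.+1)%N -> (q < m.+1)%N ->
      cell_dominates c p q.
    by move=> p q pm qm; apply: H => // u; rewrite d0.
  by rewrite c0 in cw.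
have /in_bergman[sv uv] := Bv.
have [|z [Bz sz uz Dz]] := comonotone_closure sw sv uw uv _ Bw.
  move=> p q pm qm /(class_dominates Bv dv pm qm)/(H _ _ pm qm)/(_ w); exact.
by exists z; split=> //; rewrite dv; apply/in_coarse_class.
Qed.

Lemma cell_dominates_inj (c d : cell) :
  (forall p q, (p < m.+1)%N -> (q < m.+1)%N ->
    cell_dominates c p q <-> cell_dominates d p q) -> c = d.
Proof.
move=> H; apply: val_inj.
case: (cellP c) => [c0|[w Bw cw]].
  rewrite c0; apply/esym/empty_cell_dominates => p q pm qm.
  by apply/H => // v; rewrite c0.
case: (cellP d) => [d0|[v Bv dv]].
  rewrite d0; apply/empty_cell_dominates => p q pm qm.
  by apply/H => // v; rewrite d0.
rewrite cw dv; suff eM : initial_om M w = initial_om M v.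
  by rewrite /coarse_class eM.
have /in_bergman[sw uw] := Bw; have /in_bergman[sv uv] := Bv.
apply: dominates_initial_om => // p q pm qm.
by rewrite -(class_dominates Bw cw) // -(class_dominates Bv dv) //; exact: H.
Qed.

Lemma exists_cell h : exists c : cell,
  forall p q, (p < m.+1)%N -> (q < m.+1)%N ->
    cell_dominates c p q <-> dominates h p q.
Proof.
have [D|/exists_bergman[w [sw uw Dw]]] := pselect
  (forall p q, (p < m.+1)%N -> (q < m.+1)%N -> dominates h p q).
  have c0 : set0 \in cell by rewrite inE; left.
  exists (exist (fun X => X \in cell) set0 c0) => p q pm qm; split=> [_|_ w //]; exact: D.
have Bw : positive_bergman M w by apply/in_bergman.
have cw : coarse_class M w \in cell by rewrite inE; right; exists w.
exists (exist (fun X => X \in cell) _ cw) => p q pm qm.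
by rewrite (class_dominates Bw) // Dw.
Qed.

Lemma cell_gaps (c : cell) : exists h,
  forall p q, (p < m.+1)%N -> (q < m.+1)%N ->
    cell_dominates c p q <-> dominates h p q.
Proof.
case: (cellP c) => [c0|[w Bw cw]].
  by exists (fun=> 0) => p q pm qm; split=> [_ l _ //|_ w]; rewrite c0.
by exists (gap w) => p q pm qm; exact: class_dominates.
Qed.

Lemma exists_cell_tree (c : cell) : exists t : reduced_tree m.+2,
  forall p q, (p < m.+1)%N -> (q < m.+1)%N ->
    below (clusters 0 (\val t)) p q <-> cell_dominates c p q.
Proof.
have [h hc] := cell_gaps c; have [t [rt nt ht]] := exists_tree h 0 m.+1.
have tP : reduced t && (nleaves t == m.+2) by rewrite rt nt eqxx.
by exists (exist _ t tP) => p q pm qm; rewrite hc // ht.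
Qed.

Lemma exists_tree_cell (t : reduced_tree m.+2) : exists c : cell,
  forall p q, (p < m.+1)%N -> (q < m.+1)%N ->
    below (clusters 0 (\val t)) p q <-> cell_dominates c p q.
Proof.
pose h p : R := - (count (covers^~ p) (clusters 0 (\val t)))%:R.
have [c hc] := exists_cell h; exists c => p q pm qm.
by rewrite hc // dominates_cluster_depth.
Qed.

Lemma tree_leP (t t' : reduced_tree m.+2) : tree_le t t' <->
  forall p q, (p < m.+1)%N -> (q < m.+1)%N ->
    below (clusters 0 (\val t)) p q -> below (clusters 0 (\val t')) p q.
Proof.
split=> [le p q _ _|H]; first exact: contracts_below.
have /andP[rt /eqP nt] := valP t; have /andP[rt' /eqP nt'] := valP t'.
apply: (below_contracts (a := 0)) => //; first by rewrite nt nt'.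
by rewrite nt => p q _ pm _ qm; apply: H.
Qed.

End Comonotone.

Theorem corollary6p4 (R : realType) (n : nat) (hn : (2 <= n)%N) :
  anti_isomorphic (@bergman_face_le R n) (@assoc_face_le n).
Proof.
case: n hn => [|[|m]] // _.
have /choice[F FP] := @exists_cell_tree R m.
have F_le c d : cell_le c d <-> tree_le (F d) (F c).
  rewrite cell_leP tree_leP; split=> H p q pm qm.
    by rewrite !FP //; exact: H.
  by rewrite -!FP //; exact: H.
have F_inj : injective F.
  move=> c d cd; apply: cell_dominates_inj => p q pm qm.
  by rewrite -!FP // cd.
have F_surj t : exists c, F c = t.
  have [c cP] := @exists_tree_cell R m t; exists c; apply: val_inj.
  apply: contracts_antisym; apply/tree_leP => p q pm qm.
    by rewrite FP // cP.
  by rewrite FP // cP.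
have /choice[G GK] := F_surj.
exists (omap F); split.
  exists (omap G) => -[x|] //=; last by rewrite GK.
  by congr Some; apply: F_inj; rewrite GK.
by move=> [c|] [d|] //=; exact: F_le.
Qed.
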